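(* Let $R$ be a ring and let $M_R$ be a quasi-injective right $R$-module. Then the Jacobson radical $\mathfrak{J}(\mathrm{End}(M_R))$ of the ring of endomorphisms $\mathrm{End}(M_R)$ is closed in $\mathrm{End}(M_R)$ with respect to the finite topology.
   Context: All rings are associative with identity and all modules are unitary right modules. A right module $M_R$ is called quasi-injective if every partial endomorphism of $M_R$ (i.e. every $R$-homomorphism $N\to M$ from a submodule $N\subseteq M$) can be extended to an endomorphism of $M_R$. The finite topology on $\mathrm{End}(M_R)$ is the ring topology having as a fundamental system of neighborhoods of zero the family of sets $T(K)=\{\alpha\in \mathrm{End}(M_R)\mid \alpha K=0\}$, where $K$ runs over all finite subsets of $M$. $\mathfrak{J}(S)$ denotes the Jacobson radical of a ring $S$. *)

(* Defs.v *)
From HB Require Import structures.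
From mathcomp Require Import all_boot all_algebra.
From mathcomp Require Import all_classical topology.

Set Implicit Arguments.
Unset Strict Implicit.
Unset Printing Implicit Defensive.

Import GRing.Theory.
Local Open Scope classical_set_scope.
Local Open Scope ring_scope.

(* A right R-module is an lmodType over the converse ring R^c, where the       *)
(* product x r is written r *: x.  Rings are allowed to be trivial.            *)

Section Quasi_injective.
Context (R : pzRingType) (M : lmodType R^c).

(* A submodule of M is a module N with its inclusion \val : N -> M, whose      *)
(* image is P; f is then a partial endomorphism of M.                          *)
Definition quasi_injective : Prop :=
  forall (P : pred M) (N : subLmodType P) (f : {linear N -> M}),
    exists g : {linear M -> M}, forall x : N, g (\val x) = f x.

End Quasi_injective.

Section Jacobson_radical.
Context (S : pzRingType).

Definition right_ideal (I : set S) : Prop :=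
  [/\ I 0, forall a b, I a -> I b -> I (a + b)
    & forall a s, I a -> I (a * s)].

Definition maximal_right_ideal (I : set S) : Prop :=
  [/\ right_ideal I, I <> setT
    & forall J : set S, right_ideal J -> I `<=` J -> J = I \/ J = setT].

Definition jacobson_radical : set S :=
  \bigcap_(I in maximal_right_ideal) I.

End Jacobson_radical.
Arguments jacobson_radical : clear implicits.

Definition Endo (R : pzRingType) (M : lmodType R^c) : Type := {linear M -> M}.

Definition Endo_fun (R : pzRingType) (M : lmodType R^c) (a : Endo M) : M -> M :=
  GRing.Linear.sort a.
Coercion Endo_fun : Endo >-> Funclass.

Section Endo_ring.
Context (R : pzRingType) (M : lmodType R^c).
Implicit Types a b c : Endo M.

HB.instance Definition _ := gen_eqMixin (Endo M).
HB.instance Definition _ := gen_choiceMixin (Endo M).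

Lemma EndoP a b : (forall x, a x = b x) -> a = b.
Proof.
case: a b => [f cf] [g cg] /funext /= fg.
rewrite /Endo_fun /= in fg; case: _ / fg cg => cg.
case: cf cg => [[f0] [fs]] [[g0] [gs]].
by rewrite (Prop_irrelevance f0 g0) (Prop_irrelevance fs gs).
Qed.

Definition Endo_zero : Endo M := (\0 : M -> M) : {linear M -> M}.
Definition Endo_opp a : Endo M :=
  (\- (a : {linear M -> M}) : M -> M) : {linear M -> M}.
Definition Endo_add a b : Endo M :=
  ((a : {linear M -> M}) \+ (b : {linear M -> M}) : M -> M) : {linear M -> M}.
Definition Endo_one : Endo M := (idfun : M -> M) : {linear M -> M}.
(* Endomorphisms of a right module act on the left: (a * b) x = a (b x).       *)
Definition Endo_mul a b : Endo M :=
  ((a : {linear M -> M}) \o (b : {linear M -> M}) : M -> M) : {linear M -> M}.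

Let Endo_addA : associative Endo_add.
Proof. by move=> a b c; apply: EndoP => x; exact: addrA. Qed.
Let Endo_addC : commutative Endo_add.
Proof. by move=> a b; apply: EndoP => x; exact: addrC. Qed.
Let Endo_add0 : left_id Endo_zero Endo_add.
Proof. by move=> a; apply: EndoP => x; exact: add0r. Qed.
Let Endo_addN : left_inverse Endo_zero Endo_opp Endo_add.
Proof. by move=> a; apply: EndoP => x; exact: addNr. Qed.

HB.instance Definition _ := GRing.isZmodule.Build (Endo M)
  Endo_addA Endo_addC Endo_add0 Endo_addN.

Let Endo_mulA : associative Endo_mul.
Proof. by move=> a b c; apply: EndoP. Qed.
Let Endo_mul1l : left_id Endo_one Endo_mul.
Proof. by move=> a; apply: EndoP. Qed.
Let Endo_mul1r : right_id Endo_one Endo_mul.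
Proof. by move=> a; apply: EndoP. Qed.
Let Endo_mulDl : left_distributive Endo_mul Endo_add.
Proof. by move=> a b c; apply: EndoP. Qed.
Let Endo_mulDr : right_distributive Endo_mul Endo_add.
Proof.
move=> a b c; apply: EndoP => x.
exact: (raddfD (a : {linear M -> M}) (b x) (c x)).
Qed.

HB.instance Definition _ := GRing.Zmodule_isPzRing.Build (Endo M)
  Endo_mulA Endo_mul1l Endo_mul1r Endo_mulDl Endo_mulDr.

Lemma Endo0E x : (0 : Endo M) x = 0. Proof. by []. Qed.
Lemma EndoNE a x : (- a : Endo M) x = - a x. Proof. by []. Qed.
Lemma EndoDE a b x : (a + b : Endo M) x = a x + b x. Proof. by []. Qed.
Lemma Endo1E x : (1 : Endo M) x = x. Proof. by []. Qed.
Lemma EndoME a b x : (a * b : Endo M) x = a (b x). Proof. by []. Qed.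

End Endo_ring.

Section Finite_topology.
Context (R : pzRingType) (M : lmodType R^c).
Implicit Types (a b : Endo M) (K : set M).

Definition annihilator K : set (Endo M) :=
  [set a | forall x, K x -> a x = 0].

(* The neighbourhoods of a are the supersets of the translates                 *)
(* a + annihilator K, for K finite.                                            *)
Definition finite_nbhs a : set_system (Endo M) :=
  filter_from [set K | finite_set K]
    (fun K => [set a + t | t in annihilator K]).

HB.instance Definition _ := hasNbhs.Build (Endo M) finite_nbhs.

Let finite_nbhs_filter a : ProperFilter (nbhs a).
Proof.
apply: filter_from_proper.
  apply: filter_from_filter; first by exists set0; exact: finite_set0.
  move=> K L finK finL; exists (K `|` L); first by rewrite /= finite_setU.
  by move=> _ [t tKL <-]; split; exists t => // x Kx; apply: tKL; [left|right].
by move=> K _; exists (a + 0), 0 => // x _.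
Qed.

Let finite_nbhs_singleton a (A : set (Endo M)) : nbhs a A -> A a.
Proof. by case=> K _; apply; exists 0; [move=> x _ | rewrite addr0]. Qed.

Let finite_nbhs_nbhs a (A : set (Endo M)) : nbhs a A -> nbhs a (nbhs^~ A).
Proof.
case=> K finK KA; exists K => // _ [t tK <-]; exists K => // _ [u uK <-].
apply: KA; exists (t + u); last by rewrite addrA.
by move=> x Kx; rewrite EndoDE tK // uK // addr0.
Qed.

HB.instance Definition _ := Nbhs_isNbhsTopological.Build (Endo M)
  finite_nbhs_filter finite_nbhs_singleton finite_nbhs_nbhs.

End Finite_topology.

(* Main.v *)
Require Import Defs.
From HB Require Import structures.
From mathcomp Require Import all_boot all_algebra.
From mathcomp Require Import all_classical topology.

(** Write S for End(M), J for its Jacobson radical and C for the closure of J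
    in the finite topology.

    An element c of C agrees on each finite subset of M with some element of J,
    which may depend on the subset.  Since J is a two-sided ideal, this makes C stable
    under multiplication by elements of S on both sides ([closure_jacobsonM]).
    It also makes 1 - c injective: if (1 - c) x = 0 and b in J agrees with c at
    x, then (1 - b) x = 0, and x = 0 because 1 - b is invertible
    ([closure_jacobson_injective]).

    Quasi-injectivity turns injectivity into left invertibility: the inverse
    map Im f -> M of an injective f extends to M ([injective_left_inverse]).
    So g (1 - c) = 1 for some g.  Now g = 1 - (- g c) with - g c in C, so g has
    a left inverse as well; having also the right inverse 1 - c, it is a unit
    and (1 - c) g = 1.  Thus 1 - c s is right invertible for all s, because
    c s is in C, and this says that c is in J ([jacobson_radicalP]). *)

Set Implicit Arguments.
Unset Strict Implicit.
Unset Printing Implicit Defensive.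

Import GRing.Theory.
Local Open Scope classical_set_scope.
Local Open Scope ring_scope.

(** * Quasi-regularity and the Jacobson radical *)

Section JacobsonRadical.
Context (S : pzRingType).
Implicit Types (a b s t : S) (I : set S).

Lemma right_ideal_principal a : right_ideal [set a * s | s in [set: S]].
Proof.
split; first by exists 0; rewrite ?mulr0.
- by move=> _ _ [s _ <-] [t _ <-]; exists (s + t); rewrite ?mulrDr.
- by move=> _ t [s _ <-]; exists (s * t); rewrite ?mulrA.
Qed.

Lemma right_ideal_add_principal I a : right_ideal I ->
  right_ideal [set x | exists i s, I i /\ x = i + a * s].
Proof.
case=> I0 ID IM; split.
- by exists 0, 0; rewrite mulr0 addr0.
- move=> _ _ [i [s [Ii ->]]] [j [t [Ij ->]]]; exists (i + j), (s + t).
  by split; [exact: ID | rewrite mulrDr addrACA].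
- move=> _ t [i [s [Ii ->]]]; exists (i * t), (s * t).
  by split; [exact: IM | rewrite mulrDl mulrA].
Qed.

Lemma right_ideal_setT I : right_ideal I -> I 1 -> I = setT.
Proof.
case=> _ _ IM I1; apply/seteqP; split=> // x _.
by rewrite -[x]mul1r; exact: IM.
Qed.

(** Krull's theorem.  Zorn's lemma is applied to the sets [X] such that
    [I `|` X] is a proper right ideal, so that the empty chain has the bound
    [set0].  Properness passes to unions because it means that 1 is avoided. *)
Lemma maximal_right_ideal_exists I : right_ideal I -> ~ I 1 ->
  exists2 J, maximal_right_ideal J & I `<=` J.
Proof.
move=> idI I1; have [I0 ID IM] := idI.
have [F FP Ftot|X [[idX X1] Xmax]] :=
    @Zorn_bigcup S [set X | right_ideal (I `|` X) /\ ~ (I `|` X) 1].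
  have FU X : F X -> I `|` X `<=` I `|` \bigcup_(Y in F) Y.
    by move=> FX; apply: setUS; exact: bigcup_sup.
  have directed a b : (I `|` \bigcup_(Y in F) Y) a ->
      (I `|` \bigcup_(Y in F) Y) b -> exists Y,
      [/\ right_ideal Y, Y `<=` I `|` \bigcup_(Y in F) Y, Y a & Y b].
    case=> [Ia|[X FX Xa]] [Ib|[Y FY Yb]].
    - by exists I; split=> // x Ix; left.
    - by exists (I `|` Y); split; [case: (FP Y FY)|exact: FU|left|right].
    - by exists (I `|` X); split; [case: (FP X FX)|exact: FU|right|left].
    - have [XY|YX] := Ftot _ _ FX FY.
        exists (I `|` Y); split; [by case: (FP Y FY)|exact: FU| |by right].
        by right; exact: XY.
      exists (I `|` X); split; [by case: (FP X FX)|exact: FU|by right|].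
      by right; exact: YX.
  split; last by case=> // -[X FX X1]; case: (FP X FX) => _; apply; right.
  split; first by left.
  - by move=> a b Ua /(directed _ _ Ua)[Y [[_ YD _] + Ya Yb]]; apply; exact: YD.
  - by move=> a s Ua; have [Y [[_ _ YM] + Ya _]] := directed _ _ Ua Ua; apply;
      exact: YM.
exists (I `|` X); last exact: subsetUl.
split=> // [XT|K idK XK]; first by apply: X1; rewrite XT.
have [K1|K1] := pselect (K 1); first by right; exact: right_ideal_setT.
have IK : I `|` K = K by apply/setUidPr => x Ix; apply: XK; left.
left; apply/seteqP; split=> // x Kx; right; apply: contrapT => Xx.
apply: (Xmax K); last by rewrite /mkset IK.
split; last by move=> /(_ x Kx).
by move=> y Xy; apply: XK; right.
Qed.

(** If [1 - a s] has no right inverse, it lies in a maximal right ideal, which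
    cannot contain [a] too.  Conversely, if a maximal right ideal [I] misses
    [a], then [I + a S] contains 1, so some [1 - a s] lies in [I] and is not
    right invertible. *)
Lemma jacobson_radicalP a :
  jacobson_radical S a <-> forall s, exists t, (1 - a * s) * t = 1.
Proof.
split=> [Ja s|aP I [idI InT Imax]].
  apply: contrapT => no_inv.
  have [|I maxI sI] :=
    maximal_right_ideal_exists (right_ideal_principal (1 - a * s)).
    by case=> t _ eq1; apply: no_inv; exists t.
  have Ia := Ja I maxI; case: maxI => idI InT _; apply: InT.
  apply: right_ideal_setT => //; case: idI => _ ID IM.
  rewrite -[1](subrK (a * s)); apply: ID; last exact: IM.
  by apply: sI; exists 1; rewrite ?mulr1.
apply: contrapT => Ia.
have [I0 ID IM] := idI.
have [|K_I|K_T] := Imax _ (right_ideal_add_principal a idI).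
- by move=> i Ii; exists i, 0; rewrite mulr0 addr0.
- by apply: Ia; rewrite -K_I; exists 0, 1; rewrite mulr1 add0r.
- have : [set: S] 1 by [].
  rewrite -K_T => -[i [s [Ii eq1]]]; apply: InT.
  have [t it1] := aP s.
  by apply: right_ideal_setT => //; rewrite -it1 eq1 addrK; exact: IM.
Qed.

Lemma jacobson_radicalMr a s :
  jacobson_radical S a -> jacobson_radical S (a * s).
Proof. by move=> Ja I maxI; case: (maxI) => -[_ _ IM] _ _; apply: IM; exact: Ja. Qed.

(** If [v] is a right inverse of [1 - a b], then [1 + b v a] is one of
    [1 - b a]. *)
Lemma jacobson_radicalMl a b :
  jacobson_radical S a -> jacobson_radical S (b * a).
Proof.
move=> /jacobson_radicalP Ja; apply/jacobson_radicalP => s.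
have [v vP] := Ja (s * b); exists (1 + b * v * (a * s)).
have -> : (1 - b * a * s) * (1 + b * v * (a * s)) =
    1 - b * (a * s) + b * ((1 - a * (s * b)) * v) * (a * s).
  by rewrite mulrDr mulr1 !mulrBl !mul1r mulrBr !mulrBl !mulrA.
by rewrite vP mulr1 subrK.
Qed.

Lemma left_inverse_eq_right_inverse a b s : a * b = 1 -> b * s = 1 -> a = s.
Proof. by move=> ab1 bs1; rewrite -[a]mulr1 -bs1 mulrA ab1 mul1r. Qed.

(** A right inverse [t] of [1 - a] is [1 - a (- t)], hence has a right inverse
    in its turn. *)
Lemma jacobson_radical_left_inverse a :
  jacobson_radical S a -> exists t, t * (1 - a) = 1.
Proof.
move=> /jacobson_radicalP Ja; have [t tP] := Ja 1; rewrite mulr1 in tP.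
have [u uP] := Ja (- t); exists t.
have tE : t = 1 - a * - t by rewrite mulrN opprK -tP mulrBl mul1r subrK.
by rewrite -tE in uP; rewrite (left_inverse_eq_right_inverse tP uP).
Qed.

End JacobsonRadical.

(** * Left inverses of injective endomorphisms *)

(** The image of an injective endomorphism [f], encoded as [M] itself with [f]
    as the inclusion.  The inverse of [f] on its image is then the identity. *)
Definition injective_image (R : pzRingType) (M : lmodType R^c)
  (f : {linear M -> M}) (f_inj : injective f) : Type := M.

Section InjectiveImage.
Context (R : pzRingType) (M : lmodType R^c) (f : {linear M -> M}).
Context (f_inj : injective f).
Local Notation N := (injective_image f_inj).

Definition in_image : pred M := fun y => `[< exists x, f x = y >].

Definition image_val (x : N) : M := f x.

Definition image_sub (y : M) (yP : in_image y) : N :=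
  sval (cid (asboolW yP)).

Lemma image_subK y (yP : in_image y) : image_val (image_sub yP) = y.
Proof. exact: svalP (cid (asboolW yP)). Qed.

Lemma image_sub_rect (K : N -> Type) :
  (forall y (yP : in_image y), K (image_sub yP)) -> forall x, K x.
Proof.
move=> KP x; have xP : in_image (f x) by apply/asboolP; exists x.
suff <- : image_sub xP = x by [].
by apply: f_inj; exact: image_subK.
Qed.

HB.instance Definition _ := GRing.Lmodule.on N.
HB.instance Definition _ :=
  isSub.Build M in_image N image_sub_rect image_subK.
HB.instance Definition _ :=
  GRing.isSubZmodule.Build M in_image N (raddfB f).
HB.instance Definition _ :=
  GRing.isSubLmodule.Build R^c M in_image N (linearZZ f).

Lemma injective_left_inverse : quasi_injective M ->
  exists g : {linear M -> M}, forall x, g (f x) = x.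
Proof. by move=> hM; exact: (hM in_image N (idfun : {linear M -> M})). Qed.

End InjectiveImage.

(** * The closure of the radical *)

Section ClosureOfRadical.
Context (R : pzRingType) (M : lmodType R^c).
Implicit Types a b c g s : Endo M.

Lemma closureP (A : set (Endo M)) a :
  closure A a <-> forall K, finite_set K ->
    exists2 b, A b & forall x, K x -> b x = a x.
Proof.
split=> [cl K finK|clA B [K finK KB]].
  have [|b [Ab [t tK abt]]] := cl [set a + t | t in annihilator K].
    by exists K.
  by exists b => // x Kx; rewrite -abt EndoDE tK // addr0.
have [b Ab bK] := clA K finK; exists b; split=> //; apply: KB.
exists (b - a); last by rewrite addrCA subrr addr0.
by move=> x Kx; rewrite EndoDE EndoNE bK // subrr.
Qed.

(** Left multiplication preserves agreement on [K]; for right multiplication by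
    [s], agreement is needed on the image of [K] by [s]. *)
Lemma closure_jacobsonM a c s : closure (jacobson_radical (Endo M)) c ->
  closure (jacobson_radical (Endo M)) (a * c * s).
Proof.
move=> /closureP clc; apply/closureP => K finK.
have [b Jb bK] := clc [set s x | x in K] (finite_image _ finK).
exists (a * b * s).
  by apply: jacobson_radicalMr; exact: jacobson_radicalMl.
by move=> x Kx; rewrite !EndoME bK //; exists x.
Qed.

Lemma closure_jacobson_injective c :
  closure (jacobson_radical (Endo M)) c -> injective (1 - c : Endo M).
Proof.
move=> /closureP clc x y cxy.
have [b Jb bK] := clc [set x - y] (finite_set1 _).
have [t tP] := jacobson_radical_left_inverse Jb.
apply/eqP; rewrite -subr_eq0; apply/eqP.
rewrite -[LHS](Endo1E (x - y)) -tP EndoME.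
suff -> : (1 - b : Endo M) (x - y) = 0 by exact: (linear0 (t : {linear M -> M})).
rewrite EndoDE EndoNE bK // -EndoNE -EndoDE.
have -> : (1 - c : Endo M) (x - y) = (1 - c : Endo M) x - (1 - c : Endo M) y.
  exact: (linearB ((1 - c : Endo M) : {linear M -> M})).
by rewrite cxy subrr.
Qed.

Lemma closure_jacobson_left_inverse c : quasi_injective M ->
  closure (jacobson_radical (Endo M)) c -> exists g, g * (1 - c) = 1.
Proof.
move=> hM /closure_jacobson_injective inj.
have [g gP] := injective_left_inverse (f := (1 - c : Endo M)) inj hM.
by exists g; apply: EndoP => x; exact: gP.
Qed.

(** The left inverse [g = 1 + g c] of [1 - c] has a left inverse itself, hence
    is a unit with inverse [1 - c]. *)
Lemma closure_jacobson_right_inverse c : quasi_injective M ->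
  closure (jacobson_radical (Endo M)) c -> exists g, (1 - c) * g = 1.
Proof.
move=> hM clc; have [g gP] := closure_jacobson_left_inverse hM clc.
have [|h hP] := closure_jacobson_left_inverse hM (c := - g * c * 1).
  exact: closure_jacobsonM.
have gE : g = 1 - - g * c * 1.
  by rewrite mulr1 mulNr opprK -gP mulrBr mulr1 subrK.
rewrite -gE in hP.
by exists g; rewrite -(left_inverse_eq_right_inverse hP gP).
Qed.

End ClosureOfRadical.

Theorem theorem1 (R : pzRingType) (M : lmodType R^c) (hM : quasi_injective M) :
  closed (jacobson_radical (Endo M)).
Proof.
move=> c clc; apply/jacobson_radicalP => s.
apply: closure_jacobson_right_inverse => //.
by rewrite -[c]mul1r; exact: closure_jacobsonM.
Qed.
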